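(* For every positive real $r$, there is a decision problem with restricted inputs that belongs to $C_r(0)$ (i.e., it has a zero-round randomized $(p,q)$-decider for some constants $p,q\in(0,1]$ with $p^{1+1/r}+q>1$) but that cannot be decided deterministically in $o(n)$ rounds.
   Context: Model ($\mathcal{LOCAL}$). The network is a connected graph $G$ on $n$ nodes. An identity assignment $\mathrm{Id}$ gives distinct integers to the nodes. All nodes start simultaneously, run the same algorithm, and proceed in fault-free synchronous rounds; in each round every node sends messages of unlimited size to its neighbors, receives the messages of its neighbors, and performs arbitrary local computations. Initially a node knows only its identity and its local input (in particular not $n$). Each node eventually terminates and outputs ''yes'' or ''no''; the number of rounds may vary among nodes. In $t$ rounds, the output of a node depends only on the radius-$t$ neighborhood around it (structure, identities, inputs, and random bits if any). In a randomized algorithm, each node may in addition generate private, mutually independent random bits at any round. Languages and decision problems with restricted inputs. Let $\Sigma$ be a finite or infinite set of symbols. An instance is a pair $(G,\mathbf{x})$ where $G$ is a connected $n$-node graph and $\mathbf{x}\in\Sigma^n$ assigns to each node $v$ a local input $\mathbf{x}(v)\in\Sigma$; instances are regarded as input-labelled graphs, up to isomorphism. A distributed language $\mathcal{L}$ is a decidable collection of instances. A decision problem with restricted inputs consists of a language $\mathcal{L}$ together with a set $\mathcal{I}\subseteq\bigcup_n\Sigma^n$ of allowed input vectors (a promise); an instance $(G,\mathbf{x})$ is admissible if $\mathbf{x}\in\mathcal{I}$ (admissibility being likewise invariant under isomorphism). Deciders. A deterministic algorithm decides $(\mathcal{L},\mathcal{I})$ if for every admissible instance $(G,\mathbf{x})$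 and every identity assignment $\mathrm{Id}$: all nodes output ''yes'' if $(G,\mathbf{x})\in\mathcal{L}$, and at least one node outputs ''no'' if $(G,\mathbf{x})\notin\mathcal{L}$. For constants $p,q\in(0,1]$, a randomized algorithm is a $(p,q)$-decider for $(\mathcal{L},\mathcal{I})$ if for every admissible instance and every identity assignment, every node eventually terminates with output ''yes'' or ''no'', and: if $(G,\mathbf{x})\in\mathcal{L}$ then $\Pr[\text{all nodes output ''yes''}]\ge p$; if $(G,\mathbf{x})\notin\mathcal{L}$ then $\Pr[\text{at least one node outputs ''no''}]\ge q$. The running time on $(G,\mathbf{x},\mathrm{Id})$ is the maximum, over all nodes (and all coin tosses), of the number of rounds until termination. For a positive real $r$, $C_r(0)$ is the class of all decision problems with restricted inputs that, for some constants $p,q\in(0,1]$ with $p^{1+1/r}+q>1$, have a $(p,q)$-decider running in $0$ rounds (no communication). ''Cannot be decided deterministically in $o(n)$ rounds'' means: for every function $t$ of triplets $(G,\mathbf{x},\mathrm{Id})$ with $t(G,\mathbf{x},\mathrm{Id})/n\to0$ uniformly over triplets on $n$-node graphs as $n\to\infty$, no deterministic algorithm with running time at most $t$ on all admissible instances decides the problem. *)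

(* Defs.v *)
From HB Require Import structures.
From mathcomp Require Import all_boot all_order all_algebra.
From mathcomp Require Import all_classical all_reals all_analysis.

Set Implicit Arguments.
Unset Strict Implicit.
Unset Printing Implicit Defensive.

Import Order.TTheory GRing.Theory Num.Theory.
Import numFieldNormedType.Exports.

Local Open Scope classical_set_scope.
Local Open Scope ring_scope.

(** * Instances: connected simple graphs on [{0, ..., n-1}], n > 0, whose nodes
    carry a local input *)

Record instance (Sigma : Type) := Instance {
  nnodes : nat;
  edge : rel 'I_nnodes;
  input : nnodes.-tuple Sigma;
  nnodes_gt0 : (0 < nnodes)%N;
  edge_irr : irreflexive edge;
  edge_sym : symmetric edge;
  edge_connected : forall u v, connect edge u v
}.

Definition isomorphic (Sigma : Type) (G H : instance Sigma) : Prop :=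
  exists f : 'I_(nnodes G) -> 'I_(nnodes H),
    [/\ bijective f,
        forall u v, edge (f u) (f v) = edge u v
      & forall v, tnth (input H) (f v) = tnth (input G) v].

(** * Turing machines

    One tape, infinite in both directions.  A cell is blank ([None]) or holds a
    letter ([Some (inl a)]) or an auxiliary symbol ([Some (inr w)]).  In
    [tm_step], [inl b] halts with verdict [b], and [inr (q, c, d)] goes to state
    [q], writes [c] and moves right if [d] is true and left otherwise. *)

Record turing_machine (letter : finType) := TuringMachine {
  tm_state : finType;
  tm_aux : finType;
  tm_start : tm_state;
  tm_step : tm_state -> option (letter + tm_aux) ->
            bool + (tm_state * option (letter + tm_aux) * bool)
}.

(* [l] is the tape to the left of the head, nearest cell first; [r] is the
   scanned cell followed by the tape to its right; all other cells are blank.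
   The value is the verdict if the machine halts during the first [k] steps. *)
Fixpoint tm_run (letter : finType) (M : turing_machine letter) (k : nat)
    (q : tm_state M) (l r : seq (option (letter + tm_aux M))) : option bool :=
  if k is k'.+1 then
    match tm_step q (head None r) with
    | inl b => Some b
    | inr (q', c, true) => tm_run k' q' (c :: l) (behead r)
    | inr (q', c, false) =>
        tm_run k' q' (behead l) (head None l :: c :: behead r)
    end
  else None.

Definition tm_halts (letter : finType) (M : turing_machine letter)
    (w : seq letter) (b : bool) : Prop :=
  exists k, tm_run k (tm_start M) [::] [seq Some (inl a) | a <- w] = Some b.

(* Node by node: the code of the input in unary, a separator, the row of the
   adjacency matrix, a separator.  The letter [None] is the separator. *)
Definition encode (Sigma : countType) (G : instance Sigma) :
    seq (option bool) :=
  flatten [seq nseq (pickle (tnth (input G) v)) (Some true) ++ [:: None] ++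
               [seq Some (edge v u) | u <- enum 'I_(nnodes G)] ++ [:: None]
          | v <- enum 'I_(nnodes G)].

Definition decidable_language (Sigma : countType) (L : instance Sigma -> Prop) :
    Prop :=
  exists M : turing_machine (option bool),
    forall G, exists2 b : bool, tm_halts M (encode G) b & (b <-> L G).

(** * Decision problems with restricted inputs *)

Record problem := Problem {
  symbol : countType;
  language : instance symbol -> Prop;
  allowed : seq symbol -> Prop;
  language_iso : forall G H, isomorphic G H -> language G -> language H;
  language_decidable : decidable_language language;
  allowed_perm : forall x y, perm_eq x y -> allowed x -> allowed y
}.

Definition admissible (Pi : problem) (G : instance (symbol Pi)) : Prop :=
  allowed (tval (input G)).
Arguments admissible : clear implicits.

(** * Algorithms in the LOCAL model

    A node starts in state [alg_init id x].  At the start, and again after each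
    communication round, it tosses [alg_ncoins s] private fair coins, where [s]
    is its current state, and moves to [alg_toss s w] where [w] is the list of
    outcomes.  In a round, a node in state [s] sends [alg_send s i] to its
    neighbour of identity [i]; a node receives the function that maps the
    identity of each neighbour to the message from it and all other integers to
    [None].  A node terminates when [alg_output] is first defined on its state,
    and that value is its output; it goes on relaying messages afterwards. *)

Record algorithm (Sigma : Type) := Algorithm {
  alg_state : Type;
  alg_message : Type;
  alg_init : int -> Sigma -> alg_state;
  alg_ncoins : alg_state -> nat;
  alg_toss : alg_state -> seq bool -> alg_state;
  alg_send : alg_state -> int -> alg_message;
  alg_receive : alg_state -> (int -> option alg_message) -> alg_state;
  alg_output : alg_state -> option bool
}.

Definition deterministic (Sigma : Type) (A : algorithm Sigma) : Prop :=
  forall s : alg_state A, alg_ncoins s = 0%N.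

(* [(v, k, j)] is the [j]-th coin that node [v] can toss after round [k] *)
Definition coin (n : nat) : Type := ('I_n * nat * nat)%type.

Section Execution.
Variables (Sigma : Type) (A : algorithm Sigma) (G : instance Sigma).
Variables (Id : 'I_(nnodes G) -> int) (c : coin (nnodes G) -> bool).

Definition inbox (s : 'I_(nnodes G) -> alg_state A) (v : 'I_(nnodes G))
    (i : int) : option (alg_message A) :=
  omap (fun u => alg_send (s u) (Id v)) [pick u | edge v u && (Id u == i)].

Definition toss_coins (k : nat) (v : 'I_(nnodes G)) (s : alg_state A) :
    alg_state A :=
  alg_toss s (mkseq (fun j => c (v, k, j)) (alg_ncoins s)).

Fixpoint run (k : nat) (v : 'I_(nnodes G)) : alg_state A :=
  toss_coins k v
    (if k is k'.+1 then alg_receive (run k' v) (inbox (run k') v)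
     else alg_init A (Id v) (tnth (input G) v)).

Definition terminates_with (v : 'I_(nnodes G)) (k : nat) (b : bool) : Prop :=
  alg_output (run k v) = Some b /\
  forall j, (j < k)%N -> alg_output (run j v) = None.

Definition outputs (v : 'I_(nnodes G)) (b : bool) : Prop :=
  exists k, terminates_with v k b.

End Execution.

Section Deciders.
Variables (R : realType) (Pi : problem).
Local Notation inst := (instance (symbol Pi)).

Definition always_terminates (A : algorithm (symbol Pi)) : Prop :=
  forall (G : inst) (Id : 'I_(nnodes G) -> int),
    admissible Pi G -> injective Id ->
    forall c v, exists b, outputs A Id c v b.

Definition running_time_le (A : algorithm (symbol Pi))
    (t : forall G : inst, ('I_(nnodes G) -> int) -> R) : Prop :=
  forall (G : inst) (Id : 'I_(nnodes G) -> int),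
    admissible Pi G -> injective Id ->
    forall c v, exists k b, terminates_with A Id c v k b /\ k%:R <= t G Id.

(* The coins [c] are irrelevant: a deterministic algorithm tosses none. *)
Definition deterministic_decider (A : algorithm (symbol Pi)) : Prop :=
  [/\ deterministic A, always_terminates A
    & forall (G : inst) (Id : 'I_(nnodes G) -> int),
        admissible Pi G -> injective Id -> forall c,
        (language G -> forall v, outputs A Id c v true) /\
        (~ language G -> exists v, outputs A Id c v false)].

End Deciders.

(** * Randomized deciders *)

(* The coins are mutually independent and fair. *)
Definition fair_coins d (Omega : measurableType d) (R : realType)
    (P : probability Omega R) (I : eqType) (B : Omega -> I -> bool) : Prop :=
  (forall i, measurable [set w | B w i]) /\
  forall (s : seq I) (b : I -> bool), uniq s ->
    P [set w | forall i, i \in s -> B w i = b i] = ((2^-1) ^+ size s)%:E.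

(* Which probability space carries the coins is immaterial; one exists by
   [fair_coins_exist] below. *)
Definition randomized_decider (R : realType) (Pi : problem) (p q : R)
    (A : algorithm (symbol Pi)) : Prop :=
  always_terminates A /\
  forall (G : instance (symbol Pi)) (Id : 'I_(nnodes G) -> int),
    admissible Pi G -> injective Id ->
    forall (d : measure_display) (Omega : measurableType d)
      (P : probability Omega R) (B : Omega -> coin (nnodes G) -> bool),
    fair_coins P B ->
    (language G ->
       p%:E <= P [set w | forall v, outputs A Id (B w) v true])%E /\
    (~ language G ->
       q%:E <= P [set w | exists v, outputs A Id (B w) v false])%E.

(* The class C_r(0) *)
Definition class_C0 (R : realType) (r : R) (Pi : problem) : Prop :=
  exists p q : R,
    [/\ 0 < p <= 1, 0 < q <= 1, 1 < p `^ (1 + r^-1) + q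
      & exists A : algorithm (symbol Pi),
          randomized_decider p q A /\ running_time_le A (fun _ _ => 0 : R)].

(** * Deterministic decision in sublinear time *)

Definition sublinear (R : realType) (Sigma : Type)
    (t : forall G : instance Sigma, ('I_(nnodes G) -> int) -> R) : Prop :=
  forall eps : R, 0 < eps -> exists N : nat,
    forall (G : instance Sigma) (Id : 'I_(nnodes G) -> int),
      injective Id -> (N <= nnodes G)%N -> `|t G Id / (nnodes G)%:R| < eps.

Definition decidable_in_sublinear_time (R : realType) (Pi : problem) : Prop :=
  exists t : forall G : instance (symbol Pi), ('I_(nnodes G) -> int) -> R,
    sublinear t /\
    exists A : algorithm (symbol Pi),
      deterministic_decider A /\ running_time_le A t.

(** * Existence of fair coins: the binary digits of a uniform real in [[0, 1]] *)

Lemma sum_double (F : nat -> nat) n :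
  (\sum_(k < n.*2) F k = \sum_(k < n) (F k.*2 + F k.*2.+1))%N.
Proof.
elim: n => [|n IHn]; first by rewrite !big_ord0.
by rewrite doubleS !big_ord_recr/= IHn addnA.
Qed.

(* the numbers below [2 ^ m] whose binary digits satisfy [ok] *)
Fixpoint digits_ok (ok : nat -> bool -> bool) (m k : nat) : bool :=
  if m is m'.+1 then digits_ok ok m' k./2 && ok m' (odd k) else true.

Lemma count_digits_ok ok m :
  (\sum_(k < 2 ^ m) digits_ok ok m k =
   \prod_(i < m) (ok i false + ok i true))%N.
Proof.
elim: m => [|m IHm]; first by rewrite big_ord0 expn0 big_ord1.
rewrite big_ord_recr -IHm expnS mul2n.
rewrite (sum_double (fun k => nat_of_bool (digits_ok ok m.+1 k)))/= big_distrl/=.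
apply: eq_bigr => k _.
by rewrite doubleK uphalf_double odd_double/= mulnDr !mulnb.
Qed.

Section Digits.
Variable R : realType.

Definition digit (x : R) (i : nat) : bool := odd (Num.truncn (x * 2 ^+ i.+1)).

Lemma truncn_half (y : R) : 0 <= y -> Num.truncn y = (Num.truncn (y * 2))./2.
Proof.
move=> y0; apply/truncn_def.
have := truncn_itv (mulr_ge0 y0 (ler0n R 2)).
set k := Num.truncn (y * 2) => /andP[k1 k2].
have := odd_double_half k => kE.
have : (k%:R : R) = (odd k)%:R + 2 * (k./2)%:R.
  by rewrite -[in LHS]kE natrD -mul2n natrM.
move: k2; rewrite -[in X in X -> _]natr1 => k2 kR.
rewrite -natr1.
have o0 : (0 : R) <= (odd k)%:R by rewrite ler0n.
have o1 : (odd k)%:R <= 1%:R :> R by rewrite ler_nat; case: (odd k).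
apply/andP; split.
  by rewrite -(@ler_pM2r _ 2)// mulrC; apply: le_trans k1; rewrite kR lerDr.
rewrite -(@ltr_pM2r _ 2)//; apply: lt_le_trans k2 _.
by rewrite -natr1 kR (mulrC _ 2) mulrDr mulr1 -addrA addrC -addrA lerD2l
  -[leRHS]/(1 + 1) lerD2l.
Qed.

Lemma digitsP ok m (x : R) : 0 <= x ->
  digits_ok ok m (Num.truncn (x * 2 ^+ m)) <->
  (forall i, (i < m)%N -> ok i (digit x i)).
Proof.
move=> x0; elim: m => [|m IHm]//=.
rewrite exprSr mulrA -truncn_half ?mulr_ge0 ?exprn_ge0//.
rewrite -mulrA -exprSr -/(digit x m); split.
  move=> /andP[/IHm H okm] i; rewrite ltnS leq_eqVlt => /predU1P[->//|].
  exact: H.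
move=> H; apply/andP; split; last exact: H.
by apply/IHm => i im; apply: H; exact: ltnW.
Qed.

Let P : probability (measurableTypeR R) R := uniform_prob (@ltr01 R).

Lemma P_itv (a b : R) : 0 <= a -> a <= b -> b <= 1 -> P `[a, b[%classic = (b - a)%:E.
Proof.
move=> a0 ab b1; rewrite /P/= /uniform_prob integral_uniform_pdf.
rewrite setIidl; last first.
  move=> x /=; rewrite !in_itv/= => /andP[ax xb].
  by rewrite (le_trans a0 ax) (le_trans (ltW xb) b1).
rewrite (eq_integral (cst 1%:E)); last first.
  move=> x; rewrite inE/= in_itv/= /uniform_pdf => /andP[ax xb].
  by rewrite (le_trans a0 ax) (le_trans (ltW xb) b1) subr0 invr1.
rewrite integral_cst//= mul1e lebesgue_measure_itv/= lte_fin.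
case: ltP => [_|ba]; first by rewrite EFinB.
have -> : a = b by apply/eqP; rewrite eq_le ab ba.
by rewrite subrr.
Qed.

Lemma measurable_digit i : measurable [set x : R | digit x i].
Proof.
rewrite (_ : [set x : R | digit x i] =
    \bigcup_(n in [set n | odd n])
      `[n%:R / 2 ^+ i.+1, n.+1%:R / 2 ^+ i.+1[%classic).
  by apply: bigcup_measurable => n _; exact: measurable_itv.
have p0 : (0 : R) < 2 ^+ i.+1 by rewrite exprn_gt0.
apply/seteqP; split => [x dx|x [n /= oddn]]/=; last first.
  rewrite in_itv/= ler_pdivrMr// ltr_pdivlMr// => xn.
  by rewrite /digit (truncn_def xn).
exists (Num.truncn (x * 2 ^+ i.+1)) => //=.
rewrite in_itv/= ler_pdivrMr// ltr_pdivlMr//; apply: truncn_itv.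
rewrite leNgt; apply/negP => /ltW x0; move: dx.
by rewrite /= /digit truncn_floor; case: ifPn => [h|_//]; 
   rewrite (le_anti (y := 0) (x := x * 2 ^+ i.+1)) ?x0 ?h// floor0.
Qed.

Lemma P_digits (ok : nat -> bool -> bool) m :
  P [set x | forall i, (i < m)%N -> ok i (digit x i)] =
  ((\prod_(i < m) (ok i false + ok i true))%N%:R / 2 ^+ m)%:E.
Proof.
have p0 : (0 : R) < 2 ^+ m by rewrite exprn_gt0.
pose J k : set R := `[k%:R / 2 ^+ m, k.+1%:R / 2 ^+ m[%classic.
have JP k x : J k x <-> (0 <= x /\ Num.truncn (x * 2 ^+ m) = k).
  rewrite /J/= in_itv/= ler_pdivrMr// ltr_pdivlMr//; split.
    move=> kx; split; last exact: truncn_def.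
    rewrite -(@pmulr_lge0 _ (2 ^+ m))//.
    by case/andP: kx => + _; apply: le_trans.
  by move=> [x0 <-]; apply: truncn_itv; rewrite mulr_ge0// ltW.
pose C := [set x : R | forall i, (i < m)%N -> ok i (digit x i)].
pose D : set R := `[0, 1[%classic.
have mC : measurable C.
  rewrite (_ : C =
      \bigcap_(i in [set i | (i < m)%N]) [set x | ok i (digit x i)]);
    last by apply/seteqP; split => x /=.
  apply: bigcap_measurableType => i _.
  rewrite (_ : [set x | _] = (fun x => digit x i) @^-1` [set b | ok i b])//.
  have mi : measurable_fun setT (fun x : R => digit x i).
    apply: (measurable_fun_bool true); rewrite setTI.
    rewrite (_ : _ @^-1` _ = [set x | digit x i]); last by apply/seteqP; split.
    exact: measurable_digit.
  by rewrite -[X in measurable X]setTI; apply: mi.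
have mD : measurable D by exact: measurable_itv.
pose F k := if digits_ok ok m k then J k else set0.
have mF k : measurable (F k).
  by rewrite /F; case: ifP => _; [exact: measurable_itv|exact: measurable0].
have CF : C `&` D = \big[setU/set0]_(k < (2 ^ m)%N) F k.
  rewrite -bigcup_mkord; apply/seteqP; split => x /=.
    move=> [Cx]; rewrite /D/= in_itv/= => /andP[x0 x1].
    exists (Num.truncn (x * 2 ^+ m)) => /=.
      by rewrite truncn_lt_nat ?mulr_ge0 ?(ltW p0)// natrX gtr_pMl.
    rewrite /F; case: ifPn => [_|/negP[]]; first exact/JP.
    exact/digitsP.
  move=> [k /= km]; rewrite /F; case: ifPn => // okk /JP[x0 xk]; split.
    by move=> i im; move: okk; rewrite -xk => /digitsP; exact.
  rewrite /D/= in_itv/= x0/= -(@ltr_pM2r _ (2 ^+ m))// mul1r -natrX.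
  rewrite -truncn_lt_nat ?natrX ?xk ?mulr_ge0 ?(ltW p0)//.
have PD0 : P (C `\` D) = 0%E.
  apply/eqP; rewrite eq_le measure_ge0 andbT.
  have <- : P (~` D) = 0%E.
    by rewrite probability_setC// P_itv// subr0 subee.
  apply: le_measure; rewrite ?inE//; first exact: measurableD.
  exact: measurableC.
transitivity (P C); first by [].
rewrite (measureDI P mC mD); rewrite [X in (X + _)%E]PD0 add0e CF.
rewrite measure_semi_additive_ord_I//; last 2 first.
- move=> i j _ _ [x []]; rewrite /F; case: ifP => // _ /JP[_ <-].
  by case: ifP => // _ /JP[_ <-].
- by apply: bigsetU_measurable => k _; exact: mF.
rewrite -count_digits_ok natr_sum big_distrl/= -sumEFin; apply: eq_bigr => k _.
rewrite /F; case: ifP => _; last by rewrite measure0 mul0r.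
rewrite P_itv ?divr_ge0 ?ler_pM2r ?invr_gt0 ?ler_nat//.
- by rewrite -mulrBl -natrB// subSnn.
- by rewrite ler_pdivrMr// mul1r -natrX ler_nat.
by move=> k _; exact: mF.
Qed.

Lemma fair_coins_digits : fair_coins P digit.
Proof.
split; first exact: measurable_digit.
move=> s b us.
pose m := (\max_(i <- s) i).+1.
pose ok i a := (i \in s) ==> (a == b i).
have -> : [set w | forall i, i \in s -> digit w i = b i] =
    [set x | forall i, (i < m)%N -> ok i (digit x i)].
  apply/seteqP; split => x /= H i.
    by move=> _; apply/implyP => /H ->.
  move=> si; have := H i; rewrite /ok si/= ltnS leq_bigmax_seq// => /(_ isT).
  by move=> /eqP.
rewrite P_digits; congr (_%:E).
have okE i : (ok i false + ok i true = 2 %/ 2 ^ (i \in s))%N.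
  by rewrite /ok; case: (i \in s) => //=; case: (b i).
have : ((\prod_(i < m) (ok i false + ok i true)) * 2 ^ size s = 2 ^ m)%N.
  have -> : size s = (\sum_(i < m) (val i \in s))%N.
    rewrite (perm_size (_ : perm_eq s [seq i <- iota 0 m | i \in s])).
      rewrite size_filter -sum1_count big_mkcond.
      rewrite (_ : iota 0 m = index_iota 0 m) ; last by rewrite /index_iota subn0.
      rewrite big_mkord.
      by apply: eq_bigr => i _; case: (_ \in s).
    apply: uniq_perm; rewrite ?filter_uniq ?iota_uniq// => i.
    rewrite mem_filter mem_iota add0n leq0n/=.
    by case: (boolP (i \in s)) => //= si; rewrite ltnS leq_bigmax_seq.
  rewrite expn_sum -big_split/= -[in RHS](card_ord m) -prod_nat_const.
  by apply: eq_bigr => i _; rewrite okE; case: (_ \in s).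
move=> /(congr1 (fun n => n%:R : R)); rewrite natrM !natrX => H.
have h2 n : (2 : R) ^+ n != 0 by rewrite expf_neq0.
rewrite exprVn; apply: (mulIf (h2 (size s))).
by rewrite mulVf// mulrAC H mulfV.
Qed.
End Digits.

Lemma fair_coins_exist (R : realType) (I : countType) :
  exists d (Omega : measurableType d) (P : probability Omega R)
    (B : Omega -> I -> bool), fair_coins P B.
Proof.
exists _, (measurableTypeR R), (uniform_prob (@ltr01 R)), (fun w i => digit w (pickle i)).
have [mB HB] := fair_coins_digits R; split => [i|s b us]; first exact: mB.
pose b' n := if unpickle n is Some i then b i else false.
rewrite -(size_map pickle s) -(HB _ b'); last first.
  by rewrite map_inj_uniq//; exact: pcan_inj pickleK.
congr (_ _); apply/seteqP; split => w /= H.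
  by move=> _ /mapP[i si ->]; rewrite H// /b' pickleK.
by move=> i si; rewrite H ?map_f// /b' pickleK.
Qed.

(* Main.v *)
(** Nodes are selected or not, and the language is "at most one selected"
    (amos), under the promise that at most one node or at least [m] nodes are
    selected.  If every selected node rejects with probability 1/2, then all
    nodes accept with probability [2^-c] when [c] nodes are selected, so
    [p = 1/2] and [q = 1 - 2^-m] work, and [p^(1+1/r) + q > 1] as soon as
    [m > 1 + 1/r].  A deterministic algorithm fails on a path of [m * K] nodes
    where [m] nodes are selected at mutual distances at least [K]: in fewer than
    [K / 2] rounds no node sees two of them, so every node accepts as in a legal
    instance. *)

Require Import Defs.
From mathcomp Require Import all_boot all_order all_algebra.
From mathcomp Require Import all_classical all_reals all_analysis.
From mathcomp Require Import zify lra.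
Import Order.TTheory GRing.Theory Num.Theory.
Local Open Scope ring_scope.

(** * Deciding "at most one selected node" *)

(* State [(b, s)]: [b] tells whether the head is in a row of the adjacency
   matrix, [s] whether a selected node has been read. *)
Definition amos_step (q : bool * bool) (c : option (option bool + void)) :
    bool + (bool * bool * option (option bool + void) * bool) :=
  match c, q with
  | None, _ => inl true
  | Some (inl None), (b, s) => inr (~~ b, s, c, true)
  | Some (inl (Some true)), (false, true) => inl false
  | Some (inl (Some true)), (false, false) => inr (false, true, c, true)
  | _, _ => inr (q, c, true)
  end.

Definition amos_tm : turing_machine (option bool) :=
  TuringMachine (false, false) amos_step.

(** The machine only moves right and rewrites each letter unchanged, so its run is a fold over the
    word; the blank after the word makes it accept. *)
Fixpoint amos_scan (q : bool * bool) (w : seq (option bool)) : bool :=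
  if w is a :: w' then
    match amos_step q (Some (inl a)) with
    | inl b => b
    | inr (q', _, _) => amos_scan q' w'
    end
  else true.

Lemma amos_tm_run q w l :
  @tm_run _ amos_tm (size w).+1 q l [seq Some (inl a) | a <- w] =
  Some (amos_scan q w).
Proof.
elim: w q l => [|a w IHw] [b s] l //.
by case: a b s => [[]|] [] [] //; exact: (IHw (_, _) (_ :: l)).
Qed.

Lemma amos_scan_row s row w :
  amos_scan (true, s) ([seq Some b | b <- row] ++ None :: w) =
  amos_scan (false, s) w.
Proof. by elim: row => [|[] row IHrow]. Qed.

(* [pickle true = 1] and [pickle false = 0], so the letters [Some true] outside
   the rows are in bijection with the selected nodes. *)
Lemma amos_scan_encode (T : Type) (x : pred T) (row : T -> seq bool) t s :
  amos_scan (false, s)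
    (flatten [seq nseq (pickle (x v)) (Some true) ++ [:: None] ++
                  [seq Some b | b <- row v] ++ [:: None] | v <- t]) =
  (s + count x t <= 1)%N.
Proof.
elim: t s => [|v t IHt] s /=; first by case: s.
rewrite -!catA /=.
by case: (x v); case: s => //=; rewrite -catA amos_scan_row IHt.
Qed.

Definition num_selected (G : instance bool) : nat := count id (input G).

Lemma num_selectedE G :
  num_selected G = count (tnth (input G)) (enum 'I_(nnodes G)).
Proof.
by rewrite /num_selected -[in LHS](map_tnth_enum (input G)) count_map.
Qed.

Definition amos (G : instance bool) : Prop := (num_selected G <= 1)%N.

Lemma num_selected_iso G H : isomorphic G H -> num_selected G = num_selected H.
Proof.
case=> f [bf _ fx]; rewrite !num_selectedE -!sum1_count !big_enum_cond /=.
rewrite [RHS](reindex f); last by apply: onW_bij.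
by apply: eq_bigl => v; rewrite fx.
Qed.

Lemma amos_iso G H : isomorphic G H -> amos G -> amos H.
Proof. by rewrite /amos => /num_selected_iso ->. Qed.

Lemma amos_decidable : decidable_language amos.
Proof.
exists amos_tm => G; exists (num_selected G <= 1)%N => //.
exists (size (encode G)).+1; rewrite amos_tm_run; congr Some.
pose row v := [seq edge v u | u <- enum 'I_(nnodes G)].
have := amos_scan_encode _ (tnth (input G)) row (enum 'I_(nnodes G)) false.
rewrite -num_selectedE => <-.
rewrite /encode; congr (amos_scan _ (flatten _)); apply: eq_map => v.
by rewrite /row -map_comp.
Qed.

Definition amos_allowed (m : nat) (x : seq bool) : Prop :=
  (count id x <= 1)%N || (m <= count id x)%N.

Lemma amos_allowed_perm m x y :
  perm_eq x y -> amos_allowed m x -> amos_allowed m y.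
Proof. by rewrite /amos_allowed => /permP ->. Qed.

Definition amos_problem (m : nat) : problem :=
  Problem amos_iso amos_decidable (amos_allowed_perm m).

(** * The zero-round randomized decider *)

(** From the toss on, the state says whether the node rejects. *)
Definition coin_flipper : algorithm bool :=
  {| alg_state := bool;
     alg_message := unit;
     alg_init := fun _ x => x;
     alg_ncoins := fun _ => 1%N;
     alg_toss := fun s w => s && head true w;
     alg_send := fun _ _ => tt;
     alg_receive := fun s _ => s;
     alg_output := fun s => Some (~~ s) |}.

Lemma coin_flipper_outputs (G : instance bool) (Id : 'I_(nnodes G) -> int)
    c v b :
  outputs coin_flipper Id c v b <->
  b = ~~ (tnth (input G) v && c (v, 0, 0))%N.
Proof.
split=> [[[|k] [/=]] | ->]; last by exists 0%N.
  by move=> [<-].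
by move=> _ /(_ 0%N isT).
Qed.

Section CoinFlipper.
Local Open Scope classical_set_scope.
Local Open Scope ring_scope.
Variables (R : realType) (d : measure_display) (Omega : measurableType d).
Variable P : probability Omega R.

(** [fair_coins] gives measurability coin by coin; finitely many coins give a finite intersection.
    This allows passing to the complement of [accept]. *)
Lemma measurable_coins (I : eqType) (B : Omega -> I -> bool) (s : seq I) b :
  fair_coins P B -> measurable [set w | forall i, i \in s -> B w i = b i].
Proof.
move=> [mB _]; elim: s => [|i s IHs].
  by rewrite (_ : [set w | _] = setT)//; apply/seteqP; split.
rewrite (_ : [set w | _] = [set w | B w i = b i] `&`
    [set w | forall j, j \in s -> B w j = b j]).
  apply: measurableI => //; case: (b i); first exact: mB.
  rewrite (_ : [set w | _] = ~` [set w | B w i]); first exact: measurableC.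
  by apply/seteqP; split => w /=; [move=> -> | move/negP/negbTE].
apply/seteqP; split => w /= => [H|[Hi Hs] j].
  by split=> [|j js]; apply: H; rewrite inE ?eqxx ?js ?orbT.
by rewrite inE => /predU1P[->|/Hs].
Qed.

Variables (G : instance bool) (Id : 'I_(nnodes G) -> int).
Variable B : Omega -> coin (nnodes G) -> bool.
Hypothesis B_fair : fair_coins P B.

Let accept := [set w | forall v, outputs coin_flipper Id (B w) v true].

Let coins : seq (coin (nnodes G)) :=
  [seq (v, 0, 0)%N | v <- enum 'I_(nnodes G) & tnth (input G) v].

Let acceptE : accept = [set w | forall i, i \in coins -> B w i = false].
Proof.
apply/seteqP; split => w /= H.
  move=> i /mapP[v + ->]; rewrite mem_filter => /andP[xv _].
  by move: (H v) => /coin_flipper_outputs; rewrite xv; case: (B _ _).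
move=> v; apply/coin_flipper_outputs; case xv: (tnth _ _) => //=.
by rewrite H//; apply/map_f; rewrite mem_filter xv mem_enum.
Qed.

Lemma coin_flipper_accepts : P accept = ((2^-1) ^+ num_selected G)%:E.
Proof.
rewrite acceptE (B_fair.2 coins (fun=> false)); last first.
  by rewrite map_inj_uniq => [|u v []//]; apply/filter_uniq/enum_uniq.
by rewrite size_map size_filter num_selectedE.
Qed.

Lemma coin_flipper_rejects :
  P [set w | exists v, outputs coin_flipper Id (B w) v false] =
  (1 - (2^-1) ^+ num_selected G)%:E.
Proof.
rewrite (_ : [set w | _] = ~` accept).
  rewrite probability_setC ?coin_flipper_accepts//.
  by rewrite acceptE; exact: measurable_coins.
apply/seteqP; split => w /=.
  move=> [v /coin_flipper_outputs rv] /(_ v) /coin_flipper_outputs.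
  by rewrite -rv.
move=> /existsNP[v rv]; exists v; apply/coin_flipper_outputs.
apply/esym; apply: contra_notF rv => /esym rv.
exact/coin_flipper_outputs.
Qed.

End CoinFlipper.

(** The threshold exceeds [m] by one to make the inequality strict:
    [p^(1 + 1/r) >= 2^-m > 2^-(m+1) = 1 - q]. *)
Lemma amos_problem_class_C0 (R : realType) (r : R) (m : nat) :
  0 < r -> 1 + r^-1 <= m%:R -> class_C0 r (amos_problem m.+1).
Proof.
move=> r_gt0 rm; exists 2^-1, (1 - (2^-1) ^+ m.+1).
have h0 : 0 < (2^-1 : R) by rewrite invr_gt0.
have h1 : (2^-1 : R) < 1 by rewrite invf_lt1 ?ltr1n.
have hm : (2^-1 : R) ^+ m.+1 < 2^-1 ^+ m.
  by rewrite exprS gtr_pMl// exprn_gt0.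
have hm1 : (2^-1 : R) ^+ m <= 1 by rewrite exprn_ile1// ltW.
have hm0 : 0 < (2^-1 : R) ^+ m.+1 by rewrite exprn_gt0.
have hp : (2^-1 : R) ^+ m <= 2^-1 `^ (1 + r^-1).
  rewrite -powR_mulrn ?(ltW h0)//; apply: ger_powR => //.
  by rewrite h0 ltW.
split.
- by rewrite h0 ltW.
- lra.
- lra.
exists coin_flipper; split; last first.
  by move=> G Id _ _ c v; exists 0%N; eexists; split.
split; first by move=> G Id _ _ c v; eexists; exists 0%N.
move=> G Id /= adm _ d Omega P B B_fair.
rewrite (coin_flipper_accepts _ _ _ _ G Id _ B_fair).
rewrite (coin_flipper_rejects _ _ _ _ G Id _ B_fair) !lee_fin /language/= /amos.
split=> [c1|/negP c1].
  by rewrite -[leLHS]expr1 ler_wiXn2l ?(ltW h0) ?(ltW h1).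
(* By the promise, an illegal instance has at least [m.+1] selected nodes. *)
rewrite lerD2l lerN2 ler_wiXn2l ?(ltW h0) ?(ltW h1)//.
by move: adm; rewrite /admissible/= /amos_allowed (negbTE c1).
Qed.

(** * Paths *)

Section Path.
Variables (T : Type) (n : nat).

Definition path_edge (u v : 'I_n) : bool := (u.+1 == v) || (v.+1 == u).

Lemma path_edge_irr : irreflexive path_edge.
Proof. by move=> u; rewrite /path_edge; lia. Qed.

Lemma path_edge_sym : symmetric path_edge.
Proof. by move=> u v; rewrite /path_edge orbC. Qed.

Lemma path_edge_connected u v : connect path_edge u v.
Proof.
wlog le_uv : u v / (u <= v)%N => [H|].
  have [/H//|/ltnW/H] := leqP u v.
  by rewrite (sym_connect_sym path_edge_sym).
move Ek : (v - u)%N => k; elim: k u le_uv Ek => [|k IHk] u le_uv Ek.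
  by rewrite (_ : u = v) ?connect0//; apply/val_inj => /=; lia.
have lt_un : (u.+1 < n)%N by have := ltn_ord v; lia.
apply: (connect_trans (connect1 (_ : path_edge u (Ordinal lt_un)))).
  by rewrite /path_edge eqxx.
by apply: IHk => /=; lia.
Qed.

Definition path_instance (n_gt0 : (0 < n)%N) (x : n.-tuple T) : instance T :=
  Instance x n_gt0 path_edge_irr path_edge_sym path_edge_connected.

(** Information travels one edge per round, and the ball of radius [k] around [v] in a path is the
    interval from [v - k] to [v + k]. *)
Lemma run_local (A : algorithm T) (n_gt0 : (0 < n)%N) (x y : n.-tuple T)
    (Id : 'I_n -> int) c k (v : 'I_n) :
  (forall u : 'I_n, (u <= v + k)%N -> (v <= u + k)%N -> tnth x u = tnth y u) ->
  run A (G := path_instance n_gt0 x) Id c k v =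
  run A (G := path_instance n_gt0 y) Id c k v.
Proof.
elim: k v => [|k IHk] v xy /=; first by rewrite /toss_coins xy ?addn0.
congr (toss_coins _ _ _); congr alg_receive.
  by apply: IHk => u uv vu; apply: xy; lia.
apply/funext => i; rewrite /inbox /=.
case: pickP => //= u /andP[uv _]; rewrite IHk// => u' uu' u'u.
by apply: xy; move: uv; rewrite /path_edge; lia.
Qed.

End Path.

(** * The linear lower bound *)

(* [spaced K] has its selected nodes at mutual distances at least [K].  A node
   [v] that stops in fewer than [K / 2] rounds sees the same thing as in
   [spaced_near K v], which has at most one selected node. *)
Definition spaced n (K : nat) : n.-tuple bool := [tuple (K %| i)%N | i < n].

Definition spaced_near n (K : nat) (v : 'I_n) : n.-tuple bool :=
  [tuple [&& K %| i, (i.*2 < v.*2 + K) & (v.*2 < i.*2 + K)]%N | i < n].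

(** The multiples [K * i] with [i < m] are distinct selected nodes. *)
Lemma count_spaced m K : (0 < K)%N -> (m <= count id (spaced (m * K) K))%N.
Proof.
move=> K0; rewrite -(map_tnth_enum (spaced _ _)) count_map.
rewrite -size_filter -[leqLHS](size_iota 0) -(size_map (muln K)).
rewrite -(size_map val); apply: uniq_leq_size.
  rewrite map_inj_uniq ?iota_uniq// => i j /eqP.
  by rewrite eqn_pmul2l// => /eqP.
move=> _ /mapP[i + ->]; rewrite mem_iota /= => im.
have iK : (K * i < m * K)%N by rewrite mulnC ltn_pmul2r.
apply/mapP; exists (Ordinal iK) => //.
by rewrite mem_filter/= tnth_mktuple mem_enum/= dvdn_mulr.
Qed.

(** Two selected nodes are both at distance less than [K / 2] from [v], hence less than [K] apart,
    and both are multiples of [K]. *)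
Lemma count_spaced_near n K (v : 'I_n) : (count id (spaced_near n K v) <= 1)%N.
Proof.
rewrite -(map_tnth_enum (spaced_near _ _ _)) count_map -size_filter.
set s := (X in size X).
have s_uniq : uniq s by apply/filter_uniq/enum_uniq.
have sP i : i \in s -> [&& K %| i, (i.*2 < v.*2 + K) & (v.*2 < i.*2 + K)]%N.
  by rewrite mem_filter/= tnth_mktuple => /andP[].
case: s s_uniq sP => [|i [|j s]]//= /andP[+ _] sP.
have /and3P[/dvdnP[a ia] i1 i2] := sP i (mem_head _ _).
have /and3P[/dvdnP[b jb] j1 j2] :
    [&& K %| j, (j.*2 < v.*2 + K) & (v.*2 < j.*2 + K)]%N.
  by apply: sP; rewrite !inE eqxx orbT.
have -> : i = j.
  apply/val_inj => /=; rewrite ia jb; congr (_ * _)%N.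
  by have [ab|ba|//] := ltngtP a b; nia.
by rewrite inE eqxx.
Qed.

(** Links the round given by the time bound with the verdict given by correctness. *)
Lemma terminates_with_inj (T : Type) (A : algorithm T) (G : instance T)
    (Id : 'I_(nnodes G) -> int) c v j k a b :
  terminates_with A Id c v j a -> terminates_with A Id c v k b ->
  j = k /\ a = b.
Proof.
move=> [ja before_j] [kb before_k]; have [jk|kj|jk] := ltngtP j k.
- by move: ja; rewrite before_k.
- by move: kb; rewrite before_j.
by split=> //; move: ja; rewrite jk kb => -[].
Qed.

Lemma amos_problem_not_sublinear (R : realType) m :
  (1 < m)%N -> ~ decidable_in_sublinear_time R (amos_problem m).
Proof.
move=> m1 [t [t_sub [A [[_ _ A_dec] A_time]]]].
have m0 : (0 : R) < m%:R by rewrite ltr0n ltnW.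
(* With [n = m * K], this makes the time less than [n / (2m) = K / 2]. *)
have eps0 : 0 < (2 * m%:R)^-1 :> R by rewrite invr_gt0 mulr_gt0.
have [N t_small] := t_sub _ eps0.
pose K := N.+1; pose n := (m * K)%N.
have n_gt0 : (0 < n)%N by rewrite muln_gt0 (ltnW m1).
pose Id (v : 'I_n) : int := Posz v.
have Id_inj : injective Id by move=> u v [] /val_inj.
pose c (_ : coin n) := false.
have many : (m <= count id (spaced n K))%N by exact: count_spaced.
pose G x : instance (symbol (amos_problem m)) := path_instance _ _ n_gt0 x.
have G_adm : admissible _ (G (spaced n K)).
  by rewrite /admissible/= /amos_allowed many orbT.
have [v] : exists v : 'I_n, outputs A (G := G (spaced n K)) Id c v false.
  apply: (A_dec (G (spaced n K)) Id G_adm Id_inj c).2.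
  rewrite /= /amos /num_selected /= => le1.
  by have := leq_trans (leq_trans m1 many) le1.
(* The legal instance is built around the rejecting node [v], and the time bound is applied to this
   instance. *)
pose y := spaced_near n K v.
have one : (count id y <= 1)%N by exact: count_spaced_near.
have H_adm : admissible _ (G y) by rewrite /admissible/= /amos_allowed one.
have [yes _] := A_dec (G y) Id H_adm Id_inj c.
have [k0 yes_v] := yes one v.
have [k [b [kb k_le_t]]] := A_time (G y) Id H_adm Id_inj c v.
have [_ bE] := terminates_with_inj _ _ _ _ _ _ _ _ _ _ kb yes_v.
rewrite {}bE {k0 yes_v} in kb.
have k_small : (k.*2 < K)%N.
  have nK : (n%:R : R) = m%:R * K%:R by rewrite natrM.
  have n0 : (0 : R) < n%:R by rewrite ltr0n.
  have Nn : (N <= n)%N by rewrite (leq_trans (leqnSn N))// leq_pmull// ltnW.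
  have := t_small (G y) Id Id_inj Nn.
  move=> /(le_lt_trans (ler_norm _)); rewrite ltr_pdivrMr//.
  move=> /(le_lt_trans k_le_t).
  rewrite nK invfM -mulrA mulKf ?gt_eqF// mulrC ltr_pdivlMr// -natrM ltr_nat.
  by rewrite muln2.
have same j : (j <= k)%N ->
    run A (G := G (spaced n K)) Id c j v = run A (G := G y) Id c j v.
  move=> jk; apply: run_local => u uv vu; rewrite !tnth_mktuple.
  (* Since [u] is within [k < K / 2] of [v], both inputs reduce to [K %| u]. *)
  have -> : (u.*2 < v.*2 + K)%N by lia.
  have -> : (v.*2 < u.*2 + K)%N by lia.
  by rewrite !andbT.
move=> [k' no_v].
suff yes_v : terminates_with A (G := G (spaced n K)) Id c v k true.
  by have [] := terminates_with_inj _ _ _ _ _ _ _ _ _ _ yes_v no_v.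
split=> [|j jk]; first by rewrite same// kb.1.
by rewrite same ?kb.2// ltnW.
Qed.

Theorem corollary5p2 (R : realType) (r : R) (r_gt0 : 0 < r) :
  exists Pi : problem,
    class_C0 r Pi /\ ~ decidable_in_sublinear_time R Pi.
Proof.
(* [1 + r^-1] is below [(Num.truncn r^-1).+2], and strictness costs one more. *)
exists (amos_problem (Num.truncn r^-1).+3); split.
  apply: amos_problem_class_C0 => //.
  by rewrite -natr1 addrC lerD2r ltW// truncnS_gt.
exact: amos_problem_not_sublinear.
Qed.
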